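(* For every odd integer $n\geq 1$ and for every (positive) divisor $t$ of $n$, there exists a globally simple $\mathrm{N}\mathrm{H}_t(n;n)$.
   Context: Let $n,t\ge 1$ be integers with $t$ dividing $2n^2$, let $v=2n^2+t$, and let $J$ be the subgroup of $\mathbb{Z}_v$ of order $t$. A (square, tight, relative) non-zero sum Heffter array $\mathrm{N}\mathrm{H}_t(n;n)$ is an $n\times n$ array $A$ with no empty cells and with entries in $\mathbb{Z}_v$ such that: (i) the multiset $\{\pm x \mid x\in A\}$ contains each element of $\mathbb{Z}_v\setminus J$ exactly once (and no other element); (ii) the sum of the elements in every row and in every column is different from $0$ in $\mathbb{Z}_v$. An ordering $(t_1,\dots,t_k)$ of a finite list of elements of an abelian group is simple if its partial sums $s_i=\sum_{j=1}^i t_j$, $i=1,\dots,k$, are all non-zero and pairwise distinct. A natural ordering of a row (respectively column) is the ordering of its entries read cyclically from left to right (respectively from top to bottom) starting from some chosen entry. The array is globally simple if each row and each column admits at least one natural ordering that is simple. *)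

(* Defs.v *)
From mathcomp Require Import all_boot all_order all_algebra all_fingroup cyclic.

Set Implicit Arguments.
Unset Strict Implicit.
Unset Printing Implicit Defensive.

Import GRing.Theory.
Local Open Scope ring_scope.

(* [:: s_1; ...; s_k], without the empty sum. *)
Definition partial_sums (G : zmodType) (s : seq G) : seq G := scanl +%R 0 s.

Definition simple_ordering (G : zmodType) (s : seq G) : bool :=
  (0 \notin partial_sums s) && uniq (partial_sums s).

Definition row_list (G : zmodType) n (A : 'M[G]_n) (i : 'I_n) : seq G :=
  [seq A i j | j <- enum 'I_n].

Definition col_list (G : zmodType) n (A : 'M[G]_n) (j : 'I_n) : seq G :=
  [seq A i j | i <- enum 'I_n].

Definition natural_ordering (G : zmodType) (line s : seq G) : Prop :=
  exists2 k : nat, (k < size line)%N & s = rot k line.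

Definition admits_simple_natural_ordering (G : zmodType) (line : seq G) : Prop :=
  exists2 s : seq G, natural_ordering line s & simple_ordering s.

Definition globally_simple (G : zmodType) n (A : 'M[G]_n) : Prop :=
  (forall i : 'I_n, admits_simple_natural_ordering (row_list A i)) /\
  (forall j : 'I_n, admits_simple_natural_ordering (col_list A j)).

(* The multiset {x, -x | x an entry of A}. *)
Definition pm_list (G : zmodType) n (A : 'M[G]_n) : seq G :=
  [seq A i j | i <- enum 'I_n, j <- enum 'I_n] ++
  [seq - A i j | i <- enum 'I_n, j <- enum 'I_n].

Definition NH_order (n t : nat) : nat := (2 * n ^ 2 + t)%N.

(* For n, t >= 1 the modulus 2n^2+t is at least 3, so 'Z_(NH_order n t) really *)
(* is the ring of integers modulo 2n^2+t. When moreover t divides 2n^2, its    *)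
(* additive group has exactly one subgroup J of order t (NH_subgroup_exists    *)
(* and NH_subgroup_unique below).                                              *)
Definition is_NH (n t : nat) (A : 'M['Z_(NH_order n t)]_n) : Prop :=
  exists J : {group 'Z_(NH_order n t)},
    [/\ #|J| = t,
        forall x : 'Z_(NH_order n t),
          count_mem x (pm_list A) = if x \in J then 0%N else 1%N,
        forall i : 'I_n, \sum_(j < n) A i j != 0
      & forall j : 'I_n, \sum_(i < n) A i j != 0].

Lemma Zp_group_cyclic p : cyclic [set: 'Z_p].
Proof. by rewrite Zp_cycle cycle_cyclic. Qed.

Lemma NH_subgroup_exists n t : (0 < n)%N -> (0 < t)%N -> (t %| 2 * n ^ 2)%N ->
  exists J : {group 'Z_(NH_order n t)}, #|J| = t.
Proof.
move=> n0 t0 tn.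
have v1 : (1 < NH_order n t)%N.
  apply: (@leq_trans (2 * n ^ 2)); last exact: leq_addr.
  by rewrite -[X in (X <= _)%N]/(2 * 1)%N leq_mul2l /= expn_gt0 n0.
have cardZ : #|[set: 'Z_(NH_order n t)]| = NH_order n t.
  by rewrite cardsT card_ord Zp_cast.
have dvd_t : (t %| #[Zp1 : 'Z_(NH_order n t)]%g)%N.
  by rewrite orderE -Zp_cycle cardZ dvdn_addl.
have /setP/(_ <[Zp1 ^+ (#[Zp1 : 'Z_(NH_order n t)]%g %/ t)]>%G) :=
  cycle_sub_group dvd_t.
rewrite !inE eqxx => /andP[_ /eqP cJ].
by eexists; exact: cJ.
Qed.

Lemma NH_subgroup_unique n t (J K : {group 'Z_(NH_order n t)}) :
  #|J| = t -> #|K| = t -> J = K.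
Proof.
move=> cJ cK; apply/val_inj/eqP => /=.
by rewrite (eq_subG_cyclic (Zp_group_cyclic _)) ?subsetT //= cJ cK.
Qed.

(* Main.v *)
Require Import Defs.
From mathcomp Require Import all_boot all_order all_algebra all_fingroup cyclic.
From mathcomp Require Import zify.

(** Put [M = 2n^2/t], so that [v = (M+1)t] and [J] consists of the multiples of
    [M+1]. The non-multiples of [M+1] in [[1, (v-1)/2]] are written row by row in
    increasing order with chessboard signs. Since [t] divides [n], [M] is a
    multiple of [n], so each jump over a multiple of [M+1] falls between two
    rows. Every line is then, up to a global sign, an alternating sequence
    [x_0, -x_1, x_2, ...] with [0 < x_0 < x_1 < ... < v]; any sum of consecutive
    terms of it has absolute value in [[1, v-1]], hence is non-zero modulo [v]. *)

Set Implicit Arguments.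
Unset Strict Implicit.
Unset Printing Implicit Defensive.

Import GRing.Theory FinRing.Theory.
Local Open Scope ring_scope.

(** * Signed residues modulo [v] and partial sums *)

Lemma natr_Zp_eq0 v x : (1 < v)%N -> (x%:R == 0 :> 'Z_v) = (v %| x)%N.
Proof. by move=> v1; rewrite -val_eqE /= val_Zp_nat. Qed.

(** Opposite signs would force [x + y] to vanish modulo [v], but it lies strictly between 0 and
    [v]. *)
Lemma signed_natr_Zp_inj v a b x y :
    (0 < x)%N -> (0 < y)%N -> (2 * x < v)%N -> (2 * y < v)%N ->
    (-1) ^+ a * x%:R = (-1) ^+ b * y%:R :> 'Z_v ->
  odd a = odd b /\ x = y.
Proof.
move=> x0 y0 xv yv; have v1 : (1 < v)%N by lia.
have sum_neq0 : x%:R + y%:R != 0 :> 'Z_v.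
  rewrite -natrD natr_Zp_eq0 //; apply/negP => /dvdn_leq; lia.
have natr_inj : x%:R = y%:R :> 'Z_v -> x = y.
  move/(congr1 (fun z : 'Z_v => z : nat)); rewrite !val_Zp_nat // !modn_small; lia.
rewrite -(signr_odd _ a) -(signr_odd _ b).
case: (odd a); case: (odd b); rewrite ?expr0 ?expr1 ?mul1r ?mulN1r.
- by move/oppr_inj/natr_inj.
- by move=> e; move: sum_neq0; rewrite -e subrr eqxx.
- by move=> e; move: sum_neq0; rewrite e addNr eqxx.
- by move/natr_inj.
Qed.

Lemma partial_sums_map (G : zmodType) (F : nat -> G) m :
  partial_sums [seq F i | i <- iota 0 m]
    = [seq \sum_(0 <= i < k) F i | k <- iota 1 m].
Proof.
apply: (@eq_from_nth _ 0) => [|k].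
  by rewrite size_scanl !size_map !size_iota.
rewrite size_scanl size_map size_iota => km.
rewrite nth_scanl ?size_map ?size_iota // -map_take take_iota.
rewrite (nth_map 0%N) ?size_iota // nth_iota // add1n.
rewrite (minn_idPl km) /index_iota subn0.
elim/last_ind: (iota 0 k.+1) => [|s i IHs]; first by rewrite big_nil.
by rewrite map_rcons foldl_rcons IHs big_rcons.
Qed.

(** * Alternating sums of an increasing sequence *)

Section AlternatingSums.

Variable f : nat -> nat.

(** Induction on the length: the sum carries the sign of its last term. The next term has the
    opposite sign and a strictly larger absolute value, so [u] is replaced by [f (a + k).+1 - u],
    again positive and within the bound. *)
Lemma alternating_sum_bound (R : pzRingType) (c a n k : nat) :
    (0 < f 0)%N -> {in gtn n &, {homo f : i j / (i < j)%N}} -> (a + k < n)%N ->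
  exists2 u : nat, (0 < u <= f (a + k))%N &
    \sum_(a <= i < (a + k).+1) (-1) ^+ (c + i) * (f i)%:R
      = (-1) ^+ (c + (a + k)) * u%:R :> R.
Proof.
move=> f0 fmono; elim: k => [|k IHk] akn.
  exists (f a); last by rewrite addn0 big_nat1.
  rewrite addn0 leqnn andbT; case: a akn => // a akn.
  by apply: (leq_trans f0); apply/ltnW/fmono => //; rewrite inE; lia.
have [|u /andP[u0 uf] IH] := IHk; first lia.
have flt : (f (a + k) < f (a + k.+1))%N by apply: fmono; rewrite ?inE; lia.
rewrite addnS in akn flt *.
exists (f (a + k).+1 - u)%N; first lia.
rewrite big_nat_recr /=; last lia.
rewrite IH natrB; last lia.
by rewrite addnS exprS mulN1r mulrBr !mulNr opprK addrC.
Qed.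

Variables (v n : nat).
Hypotheses (f0 : (0 < f 0)%N) (fv : forall i, (i < n)%N -> (f i < v)%N).
Hypothesis fmono : {in gtn n &, {homo f : i j / (i < j)%N}}.

Lemma alternating_sum_neq0 c a b : (a < b <= n)%N ->
  \sum_(a <= i < b) (-1) ^+ (c + i) * (f i)%:R != 0 :> 'Z_v.
Proof.
move=> /andP[ab bn]; have -> : b = (a + (b - a).-1).+1 by lia.
have akn : (a + (b - a).-1 < n)%N by lia.
have [u /andP[u0 uf] ->] :=
  alternating_sum_bound 'Z_v c f0 fmono akn.
have uv := leq_ltn_trans uf (fv akn).
rewrite mulrI_eq0; last exact/lregX/lregN/lreg1.
rewrite natr_Zp_eq0; [by apply/negP => /dvdn_leq; lia | lia].
Qed.

(** The difference of two partial sums is a sum of consecutive terms, hence non-zero. *)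
Lemma alternating_simple c :
  simple_ordering [seq (-1) ^+ (c + i) * (f i)%:R : 'Z_v | i <- iota 0 n].
Proof.
pose T k : 'Z_v := \sum_(0 <= i < k) (-1) ^+ (c + i) * (f i)%:R.
(* Prepending the empty sum 0 merges non-vanishing and distinctness into one [uniq] statement about
   [T 0], ..., [T n]. *)
rewrite /simple_ordering partial_sums_map -cons_uniq.
have -> : 0 :: [seq T k | k <- iota 1 n] = [seq T k | k <- iota 0 n.+1].
  by rewrite /= /T big_nil.
have T_neq a b : (a < b <= n)%N -> T a != T b.
  move=> abn; rewrite eq_sym -subr_eq0 /T.
  rewrite (@big_cat_nat _ _ _ a 0 b) //=; last lia.
  by rewrite [X in X - _]addrC addrK alternating_sum_neq0.
rewrite map_inj_in_uniq ?iota_uniq // => a b.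
rewrite !mem_iota => an bn eT; apply/eqP; case: ltngtP => // ab.
- by have := T_neq a b; rewrite eT eqxx => /(_ _)/implyP; lia.
- by have := T_neq b a; rewrite eT eqxx => /(_ _)/implyP; lia.
Qed.

End AlternatingSums.

(** * Lines of an array, and tools for condition (i) *)

Lemma map_enum_ord (T : Type) n (F : nat -> T) :
  [seq F i | i : 'I_n <- enum 'I_n] = [seq F i | i <- iota 0 n].
Proof. by rewrite -val_enum_ord -map_comp. Qed.

Lemma natural_ordering_refl (G : zmodType) (s : seq G) :
  (0 < size s)%N -> natural_ordering s s.
Proof. by move=> s0; exists 0%N; rewrite ?rot0. Qed.

Lemma admits_simple_alternating v n (f : nat -> nat) c :
    (0 < n)%N -> (0 < f 0)%N -> (forall i, (i < n)%N -> (f i < v)%N) ->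
    {in gtn n &, {homo f : i j / (i < j)%N}} ->
  admits_simple_natural_ordering
    [seq (-1) ^+ (c + i) * (f i)%:R : 'Z_v | i : 'I_n <- enum 'I_n].
Proof.
move=> n0 f0 fv fmono.
rewrite (map_enum_ord n (fun i => (-1) ^+ (c + i) * (f i)%:R)).
set s := map _ _; exists s; last exact: alternating_simple.
by apply: natural_ordering_refl; rewrite size_map size_iota.
Qed.

(** By Lagrange, [t] kills every element of [J], so [m * t] divides [x * t]. *)
Lemma dvdn_of_mem_Zp_group v m t (J : {group 'Z_v}) x :
  (1 < v)%N -> (0 < t)%N -> v = (m * t)%N -> #|J| = t -> x%:R \in J -> (m %| x)%N.
Proof.
move=> v1 t0 vE cJ xJ.
have := expg_cardG xJ; rewrite cJ zmodXgE -mulrnA => /eqP.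
by rewrite natr_Zp_eq0 // {1}vE dvdn_pmul2r.
Qed.

(** Pigeonhole: [s] has no repetition, avoids [B], and is long enough to fill the complement of
    [B]. *)
Lemma count_mem_of_card (T : finType) (s : seq T) (B : {set T}) x :
    uniq s -> (forall y, y \in s -> y \notin B) -> (#|T| <= size s + #|B|)%N ->
  count_mem x s = if x \in B then 0%N else 1%N.
Proof.
move=> us sB leT; rewrite count_uniq_mem //.
have eq_card : #|[set y in s]| = #|~: B|.
  apply/eqP; rewrite eqn_leq subset_leq_card /=; last first.
    by apply/subsetP => y; rewrite !inE => /sB.
  have -> : #|[set y in s]| = size s by rewrite cardsE; apply/card_uniqP.
  by rewrite -(leq_add2r #|B|) addnC cardsC.
have /setP/(_ x) : [set y in s] = ~: B.
  apply/eqP; rewrite eqEcard eq_card leqnn andbT.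
  by apply/subsetP => y; rewrite !inE => /sB.
by rewrite !inE => ->; case: (x \in B).
Qed.

(** * The array and its properties *)

Section Array.

Variables (n t : nat).
Hypotheses (n_gt0 : (0 < n)%N) (t_gt0 : (0 < t)%N).
Hypotheses (n_odd : odd n) (t_dvd_n : (t %| n)%N).

(** A block of [q] rows has [n * q] cells, the number of integers between consecutive multiples of
    [(n * q).+1]. *)
Let q := (2 * n %/ t)%N.
Let v := NH_order n t.

(** The row-major rank, counted from 1, shifted by the [i %/ q] multiples of [(n * q).+1] already
    skipped. *)
Definition entry_abs (i j : nat) : nat := (n * i + j + i %/ q).+1.

Definition NH_array : 'M['Z_v]_n :=
  \matrix_(i, j) ((-1) ^+ (i + j) * (entry_abs i j)%:R).

Let qt : (q * t = 2 * n)%N.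
Proof. by rewrite divnK // dvdn_mull. Qed.

Let q_gt0 : (0 < q)%N.
Proof. by have := qt; case: q => //; lia. Qed.

Let v_gt1 : (1 < v)%N.
Proof. by rewrite /v /NH_order; nia. Qed.

Let vE : v = ((n * q).+1 * t)%N.
Proof. by rewrite /v /NH_order; nia. Qed.

Lemma entry_abs_lt_half i j : (i < n)%N -> (j < n)%N -> (2 * entry_abs i j < v)%N.
Proof.
move=> i_lt j_lt.
have t_odd : odd t by apply: dvdn_odd t_dvd_n n_odd.
have : (2 * (i %/ q) < t)%N.
  by rewrite -(ltn_pmul2r q_gt0) [(t * q)%N]mulnC qt; have := leq_trunc_div i q; lia.
have : (n * i.+1 <= n * n)%N by rewrite leq_mul2l i_lt orbT.
rewrite /entry_abs /v /NH_order -mulnn mulnS; lia.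
Qed.

Lemma entry_abs_row_mono i : {homo entry_abs i : j k / (j < k)%N}.
Proof. by move=> j k; rewrite /entry_abs; lia. Qed.

(** Each row down adds at least [n], which exceeds [j]; the columns may differ, so this serves both
    column monotonicity and injectivity. *)
Lemma entry_abs_lt i j i' j' :
  (j < n)%N -> (i < i')%N -> (entry_abs i j < entry_abs i' j')%N.
Proof.
move=> j_lt ii'; rewrite /entry_abs ltnS.
have : (i %/ q <= i' %/ q)%N by rewrite leq_div2r // ltnW.
by nia.
Qed.

Lemma entry_abs_inj i j i' j' : (j < n)%N -> (j' < n)%N ->
  entry_abs i j = entry_abs i' j' -> i = i' /\ j = j'.
Proof.
move=> j_lt j'_lt e; case: (ltngtP i i') => [ii'|ii'|ii'].
- by have := entry_abs_lt j' j_lt ii'; rewrite e ltnn.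
- by have := entry_abs_lt j j'_lt ii'; rewrite e ltnn.
- by split=> //; move: e; rewrite ii' /entry_abs; lia.
Qed.

(** Division by [(n * q).+1] gives quotient [i %/ q] and remainder [r], with [r] between 1 and
    [n * q]. *)
Lemma entry_abs_ndvd i j : (j < n)%N -> ~~ ((n * q).+1 %| entry_abs i j)%N.
Proof.
move=> j_lt; set r := (n * (i %% q) + j).+1.
have r_lt : (r <= n * q)%N.
  by rewrite /r; have := ltn_pmod i q_gt0; nia.
have -> : entry_abs i j = (i %/ q * (n * q).+1 + r)%N.
  by rewrite /entry_abs /r {1}(divn_eq i q); nia.
by rewrite dvdn_addr ?dvdn_mull //; apply/negP => /dvdn_leq; lia.
Qed.

(** The extra signs [s] and [s'] treat entries and their opposites together. *)
Lemma NH_array_inj s s' (i j i' j' : 'I_n) :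
    (-1) ^+ s * NH_array i j = (-1) ^+ s' * NH_array i' j' ->
  [/\ odd s = odd s', i = i' & j = j'].
Proof.
rewrite !mxE !mulrA -!exprD.
case/signed_natr_Zp_inj; rewrite ?entry_abs_lt_half //.
move=> eo /entry_abs_inj [] // /val_inj ei /val_inj ej; subst i' j'.
by split=> //; move: eo; rewrite !oddD => /addIb.
Qed.

Lemma uniq_pm_list_NH_array : uniq (pm_list NH_array).
Proof.
rewrite /pm_list cat_uniq; apply/and3P; split.
- apply: allpairs_uniq; rewrite ?enum_uniq // => -[i j] [i' j'] _ _ /= e.
  by have [|_ -> ->] := @NH_array_inj 0 0 i j i' j'; rewrite // e.
(* An entry equal to the opposite of an entry would make 1 and 0 have the same parity. *)
- apply/hasPn => _ /allpairsP[[i j] [_ _ ->]]; apply/negP.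
  move=> /allpairsP[[i' j'] [_ _ /= e]].
  by have [] := @NH_array_inj 1 0 i j i' j'; rewrite // expr1 mulN1r e expr0 mul1r.
- apply: allpairs_uniq; rewrite ?enum_uniq // => -[i j] [i' j'] _ _ /= e.
  by have [|_ -> ->] := @NH_array_inj 1 1 i j i' j'; rewrite // expr1 !mulN1r e.
Qed.

Lemma pm_list_NH_array_notin (J : {group 'Z_v}) x :
  #|J| = t -> x \in pm_list NH_array -> x \notin J.
Proof.
move=> cJ; have notin i j : NH_array i j \notin J.
  rewrite !mxE -signr_odd; apply: contra (entry_abs_ndvd i (ltn_ord j)) => xJ.
  apply: (dvdn_of_mem_Zp_group v_gt1 t_gt0 vE cJ).
  move: xJ; case: odd; rewrite ?mul1r // expr1 mulN1r.
  by rewrite -zmodVgE groupV.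
rewrite mem_cat => /orP[] /allpairsP[[i j] [_ _ ->]] //.
by rewrite -zmodVgE groupV.
Qed.

Lemma NH_array_is_NH : is_NH NH_array.
Proof.
have [J cJ] : exists J : {group 'Z_v}, #|J| = t.
  by apply: NH_subgroup_exists; rewrite // dvdn_mull // expnS dvdn_mulr.
have lt_v i j : (i < n)%N -> (j < n)%N -> (entry_abs i j < v)%N.
  by move=> i_lt j_lt; have := entry_abs_lt_half i_lt j_lt; lia.
exists J; split=> // [x|i|j].
- apply: count_mem_of_card; first exact: uniq_pm_list_NH_array.
    by move=> y; apply: pm_list_NH_array_notin.
  (* The count is exact: [n * n] entries, as many opposites, and the [t] elements of [J] add up to
     [v]. *)
  have -> : #|'Z_v| = v by rewrite card_ord Zp_cast.
  rewrite cJ size_cat !size_allpairs size_enum_ord.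
  by rewrite /v /NH_order; nia.
- under eq_bigr do rewrite mxE.
  rewrite -(big_mkord xpredT (fun j => (-1) ^+ (i + j) * (entry_abs i j)%:R)).
  apply: (@alternating_sum_neq0 _ v n) => //; last by rewrite n_gt0 leqnn.
    by move=> j; apply: lt_v.
  by move=> j k _ _; apply: entry_abs_row_mono.
(* Down a column the row index varies, so [j] becomes the constant sign offset. *)
- under eq_bigr do rewrite mxE addnC.
  rewrite -(big_mkord xpredT (fun i => (-1) ^+ (j + i) * (entry_abs i j)%:R)).
  apply: (@alternating_sum_neq0 (entry_abs^~ j) v n) => //; last by rewrite n_gt0 leqnn.
    by move=> i i_lt; apply: lt_v.
  by move=> i k _ _; apply: entry_abs_lt.
Qed.

Lemma NH_array_globally_simple : globally_simple NH_array.
Proof.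
have lt_v i j : (i < n)%N -> (j < n)%N -> (entry_abs i j < v)%N.
  by move=> i_lt j_lt; have := entry_abs_lt_half i_lt j_lt; lia.
split=> [i|j].
- rewrite /row_list; under eq_map do rewrite mxE.
  apply: admits_simple_alternating => //; first by move=> j; apply: lt_v.
  by move=> j k _ _; apply: entry_abs_row_mono.
- rewrite /col_list; under eq_map do rewrite mxE addnC.
  apply: (@admits_simple_alternating _ _ (entry_abs^~ j)) => //.
    by move=> i i_lt; apply: lt_v.
  by move=> i k _ _; apply: entry_abs_lt.
Qed.

End Array.

Local Close Scope ring_scope.

Theorem theorem3p14 (n : nat) (n_ge1 : 1 <= n) (n_odd : odd n)
    (t : nat) (t_gt0 : 0 < t) (t_dvd_n : t %| n) :
  exists A : 'M['Z_(NH_order n t)]_n, is_NH A /\ globally_simple A.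
Proof.
exists (NH_array n t).
by split; [apply: NH_array_is_NH | apply: NH_array_globally_simple].
Qed.
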